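(* Let $G\in C^1(\mathbb{R}^k,\mathbb{R})$ satisfy the assumptions $(A_0)$–$(A_4)$ listed in the context. For every $\varepsilon>0$ there exists $\eta>0$ such that, for all $(u,\omega)\in H_*\times\Sigma_*$ (with $\sum_{j=1}^k C_j(u,\omega)\neq 0$, so that $\Lambda(u,\omega)$ is defined), the inequality $$\Lambda(u,\omega)<\sqrt{2\alpha}+\eta$$ implies $$|\omega_j-\sqrt{2\alpha}|<\varepsilon\qquad\text{for every }1\le j\le k.$$
   Context: Fix integers $k\ge 1$, $n\ge 3$ and real numbers $0<m_1\le m_2\le\dots\le m_k$; put $m:=m_1$. Let $\Sigma:=[0,+\infty)^k$, $\Sigma_*:=\Sigma\setminus\{0\}$, $H:=H^1(\mathbb{R}^n,\mathbb{R}^k)$ and $H_*:=H\setminus\{0\}$. Assumptions on the continuously differentiable function $G$ ($DG$ is its gradient): $(A_0)$ $G(z)=G(|z_1|,\dots,|z_k|)$. $(A_1)$ $F(z):=G(z)+\frac12\sum_{j=1}^k m_j^2z_j^2\ge 0$ for all $z$, and $G(0)=0$. $(A_2)$ $|DG(z)|\le c(|z|^{p-1}+|z|^{q-1})$ for some constant $c$ and exponents $2<p\le q<\frac{2n}{n-2}$. $(A_3)$ $\alpha:=\inf_{z\in\Sigma_*}\frac{F(z)}{|z|^2}<\frac{m^2}{2}$. $(A_4)$ For every $1\le j\le k$, $\alpha_j:=\inf\left\{\frac{F(z)}{\sum_{h\ne j}z_h^2}\ :\ \sum_{h\neq j}z_h^2\ne 0\right\}>\alpha$ (vacuous when $k=1$,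 with $\inf\emptyset=+\infty$). The energy $E:H\times\Sigma\to\mathbb{R}$ is $$E(u,\omega)=\frac12\sum_{j=1}^k\int_{\mathbb{R}^n}\left(|Du_j|^2+(m_j^2+\omega_j^2)u_j^2\right)dx+\int_{\mathbb{R}^n}G(u)\,dx,$$ the charges are $C_j(u,\omega)=\omega_j\int_{\mathbb{R}^n}u_j^2\,dx$, and the energy/charge ratio is $\Lambda(u,\omega):=\dfrac{E(u,\omega)}{\sum_{j=1}^kC_j(u,\omega)}$. *)

(* Defs.v *)
From HB Require Import structures.
From mathcomp Require Import all_boot all_order all_algebra.
From mathcomp Require Import all_classical all_reals all_analysis.

Set Implicit Arguments.
Unset Strict Implicit.
Unset Printing Implicit Defensive.

Import Order.TTheory GRing.Theory Num.Theory.
Import numFieldNormedType.Exports.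

Local Open Scope classical_set_scope.
Local Open Scope ring_scope.

(* The library norm on 'rV[R]_n is the sup norm; it is only used here for the
   topology and for differentiability. *)
Definition enorm {R : realType} {n : nat} (z : 'rV[R]_n) : R :=
  Num.sqrt (\sum_(i < n) z ord0 i ^+ 2).

(* The sigma-algebra on 'rV[R]_n generated by the coordinates, i.e. the Borel
   sigma-algebra of R^n. *)
Definition measure_rV_display : measure_display. Proof. exact. Qed.

Section measurable_rV.
Context {R : realType} (n : nat).

Let coors : 'I_n -> 'rV[R]_n -> R := fun i x => x ord0 i.

Let rV_set0 : g_sigma_preimage coors set0.
Proof. exact: sigma_algebra0. Qed.

Let rV_setC A : g_sigma_preimage coors A -> g_sigma_preimage coors (~` A).
Proof. exact: sigma_algebraC. Qed.

Let rV_bigcup (F : _^nat) : (forall i, g_sigma_preimage coors (F i)) ->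
  g_sigma_preimage coors (\bigcup_i (F i)).
Proof. exact: sigma_algebra_bigcup. Qed.

HB.instance Definition _ := @isMeasurable.Build measure_rV_display
  'rV[R]_n (g_sigma_preimage coors) rV_set0 rV_setC rV_bigcup.

End measurable_rV.

Section lebesgue_rV.
Context {R : realType}.

Lemma measurable_coord n (i : 'I_n) :
  measurable_fun [set: 'rV[R]_n] (fun x : 'rV[R]_n => x ord0 i).
Proof.
move=> _ Y mY; rewrite setTI; apply: sub_sigma_algebra => /=.
rewrite -bigcup_seq/=; exists i => /=; first by rewrite mem_index_enum.
by exists Y => //; rewrite setTI.
Qed.

Lemma measurable_fun_rV d (T : measurableType d) n (f : T -> 'rV[R]_n) :
  (forall i, measurable_fun [set: T] (fun t => f t ord0 i)) ->
  measurable_fun [set: T] f.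
Proof.
move=> mf _ A mA; rewrite setTI.
pose preim := [set B : set 'rV[R]_n | measurable (f @^-1` B)].
suff : (@measurable _ 'rV[R]_n) `<=` preim by exact.
apply: smallest_sub.
  split => [|B mB|F mF]; rewrite /preim /= ?preimage_set0//.
  - by rewrite setTD -preimage_setC; exact: measurableC.
  - by rewrite preimage_bigcup; exact: bigcupT_measurable.
rewrite -bigcup_seq => _ [i _ [C mC <-]].
by rewrite /preim /= setTI -[X in measurable X]setTI; exact: mf.
Qed.

(* (a, x) |-> (a, x_0, ..., x_(n-1)) *)
Definition cons_rV n (p : R * 'rV[R]_n) : 'rV[R]_n.+1 :=
  row_mx (p.1%:M : 'rV[R]_1) p.2.

Lemma measurable_cons_rV n : measurable_fun [set: R * 'rV[R]_n] (@cons_rV n).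
Proof.
apply: measurable_fun_rV => i.
have [j ->|j ->] := split_ordP (i : 'I_(1 + n)).
  rewrite (_ : (fun _ => _) = fst); first exact: measurable_fst.
  apply/funext => p; apply: (etrans (row_mxEl _ _ _ _)).
  by rewrite mxE (ord1 j) eqxx.
rewrite (_ : (fun _ => _) = (fun x : 'rV[R]_n => x ord0 j) \o snd).
  by apply: measurableT_comp; [exact: measurable_coord|exact: measurable_snd].
by apply/funext => p; apply: row_mxEr.
Qed.

Definition uncons_rV n (x : 'rV[R]_n.+1) : R * 'rV[R]_n :=
  (x ord0 ord0, \row_i x ord0 (lift ord0 i)).

Lemma measurable_uncons_rV n : measurable_fun [set: 'rV[R]_n.+1] (@uncons_rV n).
Proof.
apply/measurable_fun_pairP; split; first exact: measurable_coord.
apply: measurable_fun_rV => i; under eq_fun do rewrite mxE.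
exact: measurable_coord.
Qed.

Lemma cons_rVK n : cancel (@cons_rV n) (@uncons_rV n).
Proof.
move=> [a x]; congr pair.
  have -> : ord0 = lshift n (ord0 : 'I_1) by exact: val_inj.
  by apply: (etrans (row_mxEl _ _ _ _)); rewrite mxE eqxx.
apply/rowP => i; rewrite mxE.
have -> : lift ord0 i = rshift 1 i by exact: val_inj.
exact: row_mxEr.
Qed.

Section lebesgue_succ.
Local Open Scope ereal_scope.
Variables (n : nat) (mu : {sigma_finite_measure set 'rV[R]_n -> \bar R}).

Definition lebesgue_succ : set 'rV[R]_n.+1 -> \bar R :=
  pushforward (@lebesgue_measure R \x mu) (@cons_rV n).

Let lebesgue_succ0 : lebesgue_succ set0 = 0.
Proof. by rewrite /lebesgue_succ /pushforward preimage_set0 measure0. Qed.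

Let lebesgue_succ_ge0 A : 0 <= lebesgue_succ A.
Proof. exact: (measure_ge0 (lebesgue_measure \x mu)%E). Qed.

Let lebesgue_succ_sigma_additive : semi_sigma_additive lebesgue_succ.
Proof.
have mcons A : measurable A -> measurable (@cons_rV n @^-1` A).
  by move=> mA; rewrite -[X in measurable X]setTI; exact: measurable_cons_rV.
move=> F mF tF mUF; rewrite /lebesgue_succ /pushforward preimage_bigcup.
apply: (@measure_semi_sigma_additive _ _ _ (lebesgue_measure \x mu)).
- by move=> k; exact: mcons.
- apply/trivIsetP => /= i j _ _ ij; rewrite -preimage_setI.
  by move/trivIsetP : tF => /(_ _ _ _ _ ij) ->//; rewrite preimage_set0.
- by rewrite -preimage_bigcup; exact: mcons.
Qed.

HB.instance Definition _ := isMeasure.Build _ _ _ lebesgue_succ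
  lebesgue_succ0 lebesgue_succ_ge0 lebesgue_succ_sigma_additive.

Let lebesgue_succ_sigma_finite : sigma_finite setT lebesgue_succ.
Proof.
have /sigma_finiteP[F [TF ndF Foo]] := sigma_finiteT (@lebesgue_measure R).
have /sigma_finiteP[G [TG ndG Goo]] := sigma_finiteT mu.
exists (fun k => @uncons_rV n @^-1` (F k `*` G k)) => [|k].
  rewrite -preimage_bigcup -(@preimage_setT _ _ (@uncons_rV n)); congr (_ @^-1` _).
  apply/seteqP; split => // -[x y] _.
  have [i _ Fx] : (\bigcup_i F i) x by rewrite -TF.
  have [j _ Gy] : (\bigcup_i G i) y by rewrite -TG.
  exists (maxn i j) => //; split.
    by move: x Fx; exact/subsetPset/ndF/leq_maxl.
  by move: y Gy; exact/subsetPset/ndG/leq_maxr.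
have [mF Fk] := Foo k; have [mG Gk] := Goo k; split.
  by rewrite -[X in measurable X]setTI; apply: measurable_uncons_rV => //;
    exact: measurableX.
rewrite /lebesgue_succ /pushforward -comp_preimage.
rewrite (_ : _ \o _ = id) ?preimage_id; last by apply/funext => p; exact: cons_rVK.
by rewrite product_measure1E// lte_mul_pinfty// ge0_fin_numE.
Qed.

HB.instance Definition _ := Measure_isSigmaFinite.Build _ _ _ lebesgue_succ
  lebesgue_succ_sigma_finite.

End lebesgue_succ.

(* Lebesgue measure on R^n, as an n-fold product; see lebesgue_rV_box. *)
Fixpoint lebesgue_rV n : {sigma_finite_measure set 'rV[R]_n -> \bar R} :=
  match n return {sigma_finite_measure set 'rV[R]_n -> \bar R} with
  | 0%N => dirac (0 : 'rV[R]_0)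
  | n'.+1 => lebesgue_succ (lebesgue_rV n')
  end.

Lemma lebesgue_rV_box n (A : 'I_n -> set R) : (forall i, measurable (A i)) ->
  lebesgue_rV n [set x | forall i, A i (x ord0 i)] =
  (\prod_(i < n) lebesgue_measure (A i))%E.
Proof.
elim: n A => [|n IH] A mA.
  by rewrite big_ord0 /= diracE mem_set// => -[].
rewrite big_ord_recl -IH => [|i]; last exact: mA.
rewrite -product_measure1E//; last first.
  rewrite [X in measurable X](_ : _ =
    \big[setI/setT]_(i < n) (fun x : 'rV[R]_n => x ord0 i) @^-1` A (lift ord0 i)).
    apply: bigsetI_measurable => i _.
    by rewrite -[X in measurable X]setTI; exact: measurable_coord.
  rewrite -bigcap_seq/=; apply/seteqP; split => x /= Ax i.
    by move=> _; exact: Ax.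
  by apply: (Ax i); rewrite /= mem_index_enum.
  exact: mA.
rewrite /= /lebesgue_succ /pushforward; congr (product_measure1 _ _ _).
apply/seteqP; split => -[a x] /=.
  move=> Ax; have [xa xx] : uncons_rV (cons_rV (a, x)) = (a, x) by rewrite cons_rVK.
  split; first by have := Ax ord0; rewrite xa.
  by move=> i; have := Ax (lift ord0 i); rewrite -xx mxE.
have [xa xx] : uncons_rV (cons_rV (a, x)) = (a, x) by rewrite cons_rVK.
move=> [Aa Ax] i; have [j ->|->] := unliftP ord0 i; last by rewrite xa.
by have := Ax j; rewrite -{1}xx mxE.
Qed.

End lebesgue_rV.

Section sobolev.
Context {R : realType} {n : nat}.
Local Notation mu := (lebesgue_rV n).
Implicit Types (f g : 'rV[R]_n -> R) (i : 'I_n).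

Definition partial i f : 'rV[R]_n -> R := 'D_(delta_mx ord0 i) f.

Definition grad f (x : 'rV[R]_n) : 'rV[R]_n := \row_i partial i f x.

Fixpoint class_C (r : nat) f : Prop :=
  match r with
  | 0%N => continuous f
  | r'.+1 => (forall x, differentiable f x) /\ (forall i, class_C r' (partial i f))
  end.

(* C_c^oo(R^n) *)
Definition test_function f : Prop :=
  (forall r, class_C r f) /\ compact (closure [set x | f x != 0]).

Definition is_weak_partial i f g : Prop :=
  forall phi, test_function phi ->
    \int[mu]_x (f x * partial i phi x) = - \int[mu]_x (g x * phi x).

Definition L2 f : Prop := f \in Lfun mu 2%:E.

(* H^1(R^n), in terms of representatives: members are functions, and two
   functions that agree almost everywhere represent the same element. *)
Definition H1 f : Prop :=
  L2 f /\ forall i, exists g, L2 g /\ is_weak_partial i f g.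

(* A representative of the weak derivative of f in L^2 (unique up to a null set);
   the default value 0 is used only when f is not in H^1. *)
Definition weak_partial i f : 'rV[R]_n -> R :=
  xget (cst 0) [set g | L2 g /\ is_weak_partial i f g].

Definition weak_grad f (x : 'rV[R]_n) : 'rV[R]_n := \row_i weak_partial i f x.

End sobolev.

Section energy_charge.
Context {R : realType} {n k : nat}.
Variables (m : 'I_k -> R) (G : 'rV[R]_k -> R).
Local Notation mu := (lebesgue_rV n).
Implicit Types (u : 'rV[R]_n -> 'rV[R]_k) (omega z : 'rV[R]_k) (j : 'I_k).

Definition ucoord u j : 'rV[R]_n -> R := fun x => u x ord0 j.

(* H and H_*: nonzero in H means not almost everywhere zero. *)
Definition Hspace u : Prop := forall j, H1 (ucoord u j).
Definition Hstar u : Prop := Hspace u /\ ~ {ae mu, forall x, u x = 0}.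

Definition Sigma : set 'rV[R]_k := [set z | forall j, 0 <= z ord0 j].
Definition Sigma_star : set 'rV[R]_k := Sigma `\ 0.

Definition potential z : R := G z + 2^-1 * \sum_(j < k) m j ^+ 2 * z ord0 j ^+ 2.

Definition alpha : R := inf [set potential z / enorm z ^+ 2 | z in Sigma_star].

(* Taken in the extended reals, so that the value is +oo when k = 1. *)
Definition alpha_without j : \bar R :=
  ereal_inf [set (potential z / \sum_(h < k | h != j) z ord0 h ^+ 2)%:E
            | z in [set z : 'rV[R]_k | \sum_(h < k | h != j) z ord0 h ^+ 2 != 0]].

(* Integrals of general measurable functions are extended-real-valued, hence so
   are the energy and the ratio.  For u in H and G as in the theorem, G \o u is
   integrable by the growth bound on the gradient and the Sobolev embedding, and
   the energy is finite. *)
Definition field_energy u omega : \bar R :=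
  ((2^-1)%:E * \sum_(j < k) \int[mu]_x
     (enorm (weak_grad (ucoord u j) x) ^+ 2
      + (m j ^+ 2 + omega ord0 j ^+ 2) * ucoord u j x ^+ 2)%:E
   + \int[mu]_x (G (u x))%:E)%E.

Definition field_charge u omega j : R :=
  omega ord0 j * \int[mu]_x (ucoord u j x ^+ 2).

Definition energy_charge_ratio u omega : \bar R :=
  (field_energy u omega / (\sum_(j < k) field_charge u omega j)%:E)%E.

End energy_charge.

(* Main.v *)
Require Import Defs.
From HB Require Import structures.
From mathcomp Require Import all_boot all_order all_algebra.
From mathcomp Require Import all_classical all_reals all_analysis.
From mathcomp Require Import ring lra.

Set Implicit Arguments.
Unset Strict Implicit.
Unset Printing Implicit Defensive.

Import Order.TTheory GRing.Theory Num.Theory.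
Import numFieldNormedType.Exports.

Local Open Scope classical_set_scope.
Local Open Scope ring_scope.

(** Write F for the potential, a for sqrt (2 alpha), x_j for the integral of
    u_j^2 and X for the sum of the x_j.  Dropping the gradient terms, a bound
    F(z) >= sum_j b_j z_j^2 gives

      E(u, omega) >= sum_j (omega_j^2 / 2 + b_j) x_j          [energy_ge].

    It is used with two choices of b.  By definition of alpha (and evenness of
    F) one may take b_j = alpha = a^2 / 2; since

      omega_j^2 / 2 + a^2 / 2 = (omega_j - a)^2 / 2 + a omega_j,

    a ratio below a + eta forces sum_j (omega_j - a)^2 x_j to be at most a small
    multiple of X.  This only controls omega_j if x_j is not a negligible
    fraction of X.  Here the second choice enters: as all the infima alpha_j
    exceed alpha, there is a single alpha' > alpha with
    F(z) >= alpha' sum_(h != j) z_h^2 for every j.  Were x_j negligible, this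
    would give an energy of about alpha' X instead of alpha X, and a ratio
    staying away from a.  Hence x_j is at least a fixed fraction of X, and
    (omega_j - a)^2 is small: see frequency_close for the elementary estimate. *)

(** * Monotonicity of the integral *)

(** The integral of a nonnegative function is a supremum over the simple functions
    below it, so it is monotone without any measurability; applied to the positive
    and negative parts, this lets G \o u be bounded below by an integrable
    function before anything is known about its own integrability. *)
Lemma integral_le_nonmeasurable d (T : measurableType d) (R : realType)
    (mu : {measure set T -> \bar R}) (f g : T -> \bar R) :
  (forall x, f x <= g x)%E -> (\int[mu]_x f x <= \int[mu]_x g x)%E.
Proof.
move=> fg.
have mono (f0 g0 : T -> \bar R) : (forall x, 0 <= f0 x)%E ->
    (forall x, f0 x <= g0 x)%E -> (\int[mu]_x f0 x <= \int[mu]_x g0 x)%E.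
  move=> f00 fg0; have g00 x : (0 <= g0 x)%E := le_trans (f00 x) (fg0 x).
  rewrite !ge0_integralTE//; apply: ereal_sup_le => _ [h /= hf <-].
  by exists h => // x; exact: le_trans (hf x) (fg0 x).
rewrite integralE [leRHS]integralE; apply: leeB; apply: mono => x //.
- by apply: (@funepos_le _ _ setT) => //; rewrite inE.
- by apply: (@funeneg_le _ _ setT) => //; rewrite inE.
Qed.

(** * Lower bound for the energy *)

Section energy_lower_bound.
Context {R : realType} {n k : nat}.
Variables (m : 'I_k -> R) (G : 'rV[R]_k -> R).
Local Notation mu := (lebesgue_rV n).

Let mass (u : 'rV[R]_n -> 'rV[R]_k) (j : 'I_k) : R :=
  \int[mu]_x (ucoord u j x ^+ 2).

Lemma integrable_ucoord_sqr (u : 'rV[R]_n -> 'rV[R]_k) j : Hspace u ->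
  mu.-integrable setT (fun x => (ucoord u j x ^+ 2)%:E).
Proof. by move=> /(_ j)[uL2 _]; exact: Lfun2_integrable_sqr. Qed.

Lemma integral_ucoord_sqrZ (u : 'rV[R]_n -> 'rV[R]_k) (c : R) j : Hspace u ->
  (\int[mu]_x (c * ucoord u j x ^+ 2)%:E = (c * mass u j)%:E)%E.
Proof.
move=> Hu; have iu := integrable_ucoord_sqr j Hu.
under eq_integral do rewrite EFinM.
by rewrite integralZl// EFinM /mass fineK//; exact: integrable_fin_num.
Qed.

Lemma integral_quadratic (u : 'rV[R]_n -> 'rV[R]_k) (c : 'I_k -> R) : Hspace u ->
  (\int[mu]_x (\sum_(j < k) c j * ucoord u j x ^+ 2)%:E =
   (\sum_(j < k) c j * mass u j)%:E)%E.
Proof.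
move=> Hu; under eq_integral do rewrite -sumEFin.
rewrite integral_sum//.
  by rewrite -sumEFin; apply: eq_bigr => j _; exact: integral_ucoord_sqrZ.
move=> j; under eq_fun do rewrite EFinM.
by apply: integrableZl => //; exact: integrable_ucoord_sqr.
Qed.

(** The part m_j^2 of the mass term is what turns G into F: it compensates the
    - m_j^2 z_j^2 / 2 in the lower bound for G.  That lower bound has an integrable
    composition with u, so the inequality also holds if the energy is +oo. *)
Lemma energy_ge (b : 'I_k -> R) (u : 'rV[R]_n -> 'rV[R]_k) (omega : 'rV[R]_k) :
  Hspace u ->
  (forall z : 'rV[R]_k, \sum_(j < k) b j * z ord0 j ^+ 2 <= potential m G z) ->
  ((\sum_(j < k) (omega ord0 j ^+ 2 / 2 + b j) * mass u j)%:E
    <= field_energy m G u omega)%E.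
Proof.
move=> Hu bF.
have kinetic j : (((m j ^+ 2 + omega ord0 j ^+ 2) * mass u j)%:E <=
    \int[mu]_x (enorm (weak_grad (ucoord u j) x) ^+ 2
      + (m j ^+ 2 + omega ord0 j ^+ 2) * ucoord u j x ^+ 2)%:E)%E.
  rewrite -integral_ucoord_sqrZ//; apply: integral_le_nonmeasurable => x.
  by rewrite lee_fin lerDr sqr_ge0.
have interaction : ((\sum_(j < k) (b j - m j ^+ 2 / 2) * mass u j)%:E <=
    \int[mu]_x (G (u x))%:E)%E.
  rewrite -integral_quadratic//; apply: integral_le_nonmeasurable => x.
  rewrite lee_fin; have := bF (u x).
  rewrite /potential mulr_sumr -lerBlDr; apply: le_trans.
  rewrite -sumrN -big_split/= le_eqVlt; apply/orP; left; apply/eqP.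
  by apply: eq_bigr => j _; rewrite /ucoord; lra.
apply: (@le_trans _ _ ((2^-1)%:E * \sum_(j < k)
    ((m j ^+ 2 + omega ord0 j ^+ 2) * mass u j)%:E
    + (\sum_(j < k) (b j - m j ^+ 2 / 2) * mass u j)%:E)%E).
  rewrite sumEFin -EFinM -EFinD lee_fin mulr_sumr -big_split/=.
  by apply: ler_sum => j _; lra.
rewrite /field_energy; apply: leeD => //.
by apply: lee_wpmul2l; [rewrite lee_fin; lra|exact: lee_sum].
Qed.

End energy_lower_bound.

(** * Quadratic lower bounds for the potential *)

Section potential_bounds.
Context {R : realType} {k : nat}.
Variables (m : 'I_k -> R) (G : 'rV[R]_k -> R).
Hypothesis F_ge0 : forall z, 0 <= potential m G z.

Lemma enorm_sqr (z : 'rV[R]_k) : enorm z ^+ 2 = \sum_(j < k) z ord0 j ^+ 2.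
Proof. by rewrite sqr_sqrtr// sumr_ge0// => j _; exact: sqr_ge0. Qed.

Let ratio_lbound :
  lbound [set potential m G z / enorm z ^+ 2 | z in Sigma_star] 0.
Proof. by move=> _ [z _ <-]; rewrite divr_ge0 ?sqr_ge0. Qed.

Lemma alpha_ge0 : (0 < k)%N -> 0 <= alpha m G.
Proof.
move=> k_gt0; apply: lb_le_inf; last exact: ratio_lbound.
pose z : 'rV[R]_k := const_mx 1; exists (potential m G z / enorm z ^+ 2).
exists z => //; split=> [j|/rowP/(_ (Ordinal k_gt0))]; first by rewrite mxE ler01.
by rewrite !mxE => /eqP; rewrite oner_eq0.
Qed.

(** The infimum defining alpha runs over nonnegative z only; evenness of the
    potential in each coordinate extends the bound to all z. *)
Lemma potential_ge_alpha (z : 'rV[R]_k) :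
  (forall y, G y = G (\row_j `|y ord0 j|)) ->
  \sum_(j < k) alpha m G * z ord0 j ^+ 2 <= potential m G z.
Proof.
move=> Gabs; pose y : 'rV[R]_k := \row_j `|z ord0 j|.
have sqr_abs j : y ord0 j ^+ 2 = z ord0 j ^+ 2 by rewrite mxE real_normK ?num_real.
have -> : potential m G z = potential m G y.
  rewrite /potential -Gabs; congr (_ + _ * _).
  by apply: eq_bigr => j _; rewrite sqr_abs.
have -> : \sum_(j < k) alpha m G * z ord0 j ^+ 2 = alpha m G * enorm y ^+ 2.
  by rewrite enorm_sqr mulr_sumr; apply: eq_bigr => j _; rewrite sqr_abs.
have [y0|y0] := eqVneq (enorm y ^+ 2) 0; first by rewrite y0 mulr0.
rewrite -ler_pdivlMr ?lt_def ?y0 ?sqr_ge0//.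
apply: ge_inf; first by exists 0; exact: ratio_lbound.
exists y => //; split=> [j|/= y_eq0]; first by rewrite mxE.
move/eqP: y0; apply; rewrite enorm_sqr big1// => j _.
by rewrite y_eq0 mxE expr0n.
Qed.

(** The indicator of h != j puts the bound in the form that energy_ge takes.  When
    the reduced sum of squares vanishes, as it always does for k = 1, the bound
    is just nonnegativity of the potential. *)
Lemma potential_ge_without (b : R) (j : 'I_k) (z : 'rV[R]_k) :
  (b%:E <= alpha_without m G j)%E ->
  \sum_(h < k) (h != j)%:R * b * z ord0 h ^+ 2 <= potential m G z.
Proof.
move=> b_le.
have -> : \sum_(h < k) (h != j)%:R * b * z ord0 h ^+ 2 =
    b * \sum_(h < k | h != j) z ord0 h ^+ 2.
  rewrite mulr_sumr [RHS]big_mkcond/=; apply: eq_bigr => h _.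
  by case: (h != j); rewrite ?mul1r ?mul0r.
have [z0|z0] := eqVneq (\sum_(h < k | h != j) z ord0 h ^+ 2) 0.
  by rewrite z0 mulr0.
rewrite -ler_pdivlMr; last first.
  by rewrite lt_def z0 sumr_ge0// => h _; exact: sqr_ge0.
by rewrite -lee_fin (le_trans b_le)//; apply: ereal_inf_lbound; exists z.
Qed.

End potential_bounds.

(** The values of f may be +oo; the bound a + 1 covers these, and the case of an
    empty I. *)
Lemma uniform_lower_gap (R : realType) (I : finType) (a : R) (f : I -> \bar R) :
  (forall i, a%:E < f i)%E -> exists2 b : R, a < b & forall i, (b%:E <= f i)%E.
Proof.
move=> af.
have /choice[g g_spec] i : exists b : R, a < b /\ (b%:E <= f i)%E.
  case: (f i) (af i) => [r|_|]; last by [].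
  - by rewrite lte_fin => ar; exists r.
  - by exists (a + 1); rewrite ltrDl leey.
exists (\big[Num.min/(a + 1)]_i g i) => [|i].
  by apply: lt_bigmin => [|i _]; [rewrite ltrDl|have [] := g_spec i].
by apply: le_trans (g_spec i).2; rewrite lee_fin bigmin_le.
Qed.

(** * Closeness of the frequencies *)

Section frequency_estimate.
Context {R : realType} {k : nat}.
Variables (a alpha' eta theta : R) (x omega : 'I_k -> R) (j : 'I_k).
Hypothesis x_ge0 : forall h, 0 <= x h.
Hypothesis eta_theta : eta * (a + eta) <= theta.
Hypothesis energy_small : \sum_(h < k) (omega h ^+ 2 / 2 + a ^+ 2 / 2) * x h
  < (a + eta) * \sum_(h < k) omega h * x h.
Hypothesis energy_small_without :
  \sum_(h < k) (omega h ^+ 2 / 2 + (h != j)%:R * alpha') * x h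
  < (a + eta) * \sum_(h < k) omega h * x h.

(** Completing the square turns both hypotheses into statements on
    S = sum_h (omega_h - a)^2 x_h, with the error term eta * sum_h omega_h x_h on
    the right.  By eta * omega <= eta * (a + eta) + (omega - a)^2 / 4, that error
    costs theta X and half of the S / 2 available on the left.  The first
    conclusion bounds one term of S, and the second says that x_j is not
    negligible. *)
Lemma frequency_bounds :
  (omega j - a) ^+ 2 * x j < 4 * theta * \sum_(h < k) x h /\
  (alpha' - a ^+ 2 / 2 - theta) * \sum_(h < k) x h < alpha' * x j.
Proof.
set X := \sum_(h < k) x h; set S := \sum_(h < k) (omega h - a) ^+ 2 * x h.
have term0 h : 0 <= (omega h - a) ^+ 2 * x h by rewrite mulr_ge0 ?sqr_ge0.
have S0 : 0 <= S by apply: sumr_ge0.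
have xS : (omega j - a) ^+ 2 * x j <= S.
  by rewrite /S (bigD1 j)//= lerDl sumr_ge0.
have charge_le : eta * \sum_(h < k) omega h * x h <= theta * X + S / 4.
  rewrite /X /S mulr_suml !mulr_sumr -big_split/=; apply: ler_sum => h _.
  have : eta * omega h <= theta + (omega h - a) ^+ 2 / 4.
    by have := sqr_ge0 ((omega h - a) / 2 - eta); move: eta_theta; lra.
  by move=> /(ler_wpM2r (x_ge0 h)); lra.
have square1 : \sum_(h < k) (omega h ^+ 2 / 2 + a ^+ 2 / 2) * x h =
    S / 2 + a * \sum_(h < k) omega h * x h.
  rewrite /S mulr_suml mulr_sumr -big_split/=; apply: eq_bigr => h _; lra.
have square2 : \sum_(h < k) (omega h ^+ 2 / 2 + (h != j)%:R * alpha') * x h =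
    S / 2 + a * \sum_(h < k) omega h * x h + (alpha' - a ^+ 2 / 2) * X - alpha' * x j.
  rewrite -square1 /X.
  have -> : x j = \sum_(h < k) (h == j)%:R * x h.
    rewrite (bigD1 j)//= eqxx mul1r big1 ?addr0// => h /negPf ->.
    by rewrite mul0r.
  rewrite !mulr_sumr -sumrN -!big_split/=; apply: eq_bigr => h _.
  case: (h == j) => /=; lra.
move: energy_small energy_small_without; rewrite square1 square2 => E1 E2.
split; lra.
Qed.

Lemma frequency_close (epsilon : R) : 0 < epsilon -> 0 < alpha' ->
  theta <= (alpha' - a ^+ 2 / 2) / 2 ->
  theta * (8 * alpha') <= epsilon ^+ 2 * (alpha' - a ^+ 2 / 2) ->
  `|omega j - a| < epsilon.
Proof.
move=> eps_gt0 alpha'_gt0 theta_gap theta_eps.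
have [bound_square] := frequency_bounds.
set X := \sum_(h < k) x h in bound_square *; set gap := alpha' - a ^+ 2 / 2.
move=> bound_mass.
have X_ge0 : 0 <= X by apply: sumr_ge0.
rewrite ltNge; apply/negP => eps_le.
have eps_square : epsilon ^+ 2 <= (omega j - a) ^+ 2.
  by rewrite -[leRHS]real_normK ?num_real// ler_sqr ?nnegrE// ltW.
(* both inequalities bound epsilon^2 * alpha' * x_j, in opposite directions *)
have upper : alpha' * (epsilon ^+ 2 * x j) < alpha' * (4 * theta * X).
  by rewrite ltr_pM2l//; apply: le_lt_trans bound_square; apply: ler_wpM2r.
have lower : epsilon ^+ 2 * (gap / 2 * X) <= epsilon ^+ 2 * (alpha' * x j).
  rewrite ler_wpM2l ?sqr_ge0// ltW// (le_lt_trans _ bound_mass)//.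
  by apply: ler_wpM2r => //; rewrite /gap; lra.
have := ler_wpM2r X_ge0 theta_eps; rewrite -/gap; lra.
Qed.

End frequency_estimate.

Theorem mainTheorem6 (R : realType) (k n : nat) (k_gt0 : (1 <= k)%N)
    (n_ge3 : (3 <= n)%N)
    (m : 'I_k -> R) (m1_gt0 : 0 < m (Ordinal k_gt0))
    (m_nondecreasing : forall i j : 'I_k, (i <= j)%N -> m i <= m j)
    (G : 'rV[R]_k -> R) (G_C1 : class_C 1 G)
    (A0 : forall z : 'rV[R]_k, G z = G (\row_j `|z ord0 j|))
    (A1 : (forall z, 0 <= potential m G z) /\ G 0 = 0)
    (A2 : exists c p q : R,
      [/\ 2 < p, p <= q, q < 2 * n%:R / (n%:R - 2) &
        forall z, enorm (grad G z)
          <= c * (enorm z `^ (p - 1) + enorm z `^ (q - 1))])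
    (A3 : alpha m G < m (Ordinal k_gt0) ^+ 2 / 2)
    (A4 : forall j : 'I_k, ((alpha m G)%:E < alpha_without m G j)%E)
    (epsilon : R) (epsilon_gt0 : 0 < epsilon) :
  exists eta : R, 0 < eta /\
    forall (u : 'rV[R]_n -> 'rV[R]_k) (omega : 'rV[R]_k),
      Hstar u -> Sigma_star omega ->
      \sum_(j < k) field_charge u omega j != 0 ->
      (energy_charge_ratio m G u omega < (Num.sqrt (2 * alpha m G) + eta)%:E)%E ->
      forall j : 'I_k, `|omega ord0 j - Num.sqrt (2 * alpha m G)| < epsilon.
Proof.
have [F_ge0 _] := A1.
have alpha_nneg : 0 <= alpha m G by exact: alpha_ge0.
have [alpha' alpha_lt alpha'_le] := uniform_lower_gap A4.
set a := Num.sqrt (2 * alpha m G).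
have a_ge0 : 0 <= a by exact: sqrtr_ge0.
have alphaE : a ^+ 2 / 2 = alpha m G by rewrite sqr_sqrtr; lra.
have alpha'_gt0 : 0 < alpha' by lra.
pose gap := alpha' - alpha m G.
have gap_gt0 : 0 < gap by rewrite /gap; lra.
(* theta <= 1 makes eta <= 1, hence eta * (a + eta) <= theta; the other two terms
   are the smallness conditions of frequency_close *)
pose theta := Num.min 1 (Num.min (gap / 2) (epsilon ^+ 2 * gap / (8 * alpha'))).
have theta_gt0 : 0 < theta.
  by rewrite /theta !lt_min ltr01/= !divr_gt0 ?mulr_gt0 ?exprn_gt0.
have theta_le1 : theta <= 1 by rewrite /theta ge_min lexx.
have theta_gap : theta <= gap / 2 by rewrite /theta !ge_min lexx ?orbT.
have theta_eps : theta * (8 * alpha') <= epsilon ^+ 2 * gap.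
  by rewrite -ler_pdivlMr ?mulr_gt0// /theta !ge_min lexx ?orbT.
have a1_gt0 : 0 < a + 1 by lra.
pose eta := theta / (a + 1).
have eta_gt0 : 0 < eta by rewrite divr_gt0.
have eta_mul : eta * (a + 1) = theta by rewrite divfK// gt_eqF.
have eta_le1 : eta <= 1.
  by rewrite /eta ler_pdivrMr// mul1r; lra.
have eta_theta : eta * (a + eta) <= theta.
  by rewrite -eta_mul ler_pM2l// lerD2l.
exists eta; split=> // u omega [Hu _] [omega_ge0 _] charge_neq0 ratio_lt j.
pose x h := \int[lebesgue_rV n]_y (ucoord u h y ^+ 2).
have x_ge0 h : 0 <= x h by apply: Rintegral_ge0 => y _; exact: sqr_ge0.
have charge_gt0 : 0 < \sum_(h < k) field_charge u omega h.
  rewrite lt_def charge_neq0 sumr_ge0// => h _.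
  by apply: mulr_ge0; [exact: omega_ge0|exact: x_ge0].
have energy_lt : (field_energy m G u omega
    < ((a + eta) * \sum_(h < k) omega ord0 h * x h)%:E)%E.
  move: ratio_lt; rewrite /energy_charge_ratio inver gt_eqF//.
  by rewrite lte_pdivrMr// -EFinM.
apply: (@frequency_close _ _ a alpha' eta theta x (fun h => omega ord0 h)) => //.
- rewrite -lte_fin; apply: le_lt_trans energy_lt.
  rewrite alphaE; apply: energy_ge (fun=> alpha m G) _ _ Hu _ => z.
  exact: potential_ge_alpha.
- rewrite -lte_fin; apply: le_lt_trans energy_lt.
  apply: energy_ge (fun h => (h != j)%:R * alpha') _ _ Hu _ => z.
  exact: potential_ge_without.
- by rewrite alphaE.
- by rewrite alphaE.
Qed.
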